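(* Let $\rho > 1$ and let $f$ be analytic inside and on the Bernstein ellipse $\mathcal{E}_\rho$. Let $a_n$ denote the Chebyshev coefficients of the first kind of $f$. Then for each integer $n \geq 0$, $$a_n = \frac{1}{\pi \rho^n} \int_{0}^{2\pi} f\left( \tfrac{1}{2}\left(\rho e^{i\theta} + (\rho e^{i\theta})^{-1}\right) \right) e^{-in\theta}\, d\theta.$$
   Context: For $\rho \ge 1$ the Bernstein ellipse is $\mathcal{E}_\rho = \{ z \in \mathbb{C} : z = \frac12(\rho e^{i\theta} + \rho^{-1}e^{-i\theta}),\ 0 \le \theta \le 2\pi\}$ (an ellipse with foci $\pm 1$; its interior contains $[-1,1]$ when $\rho>1$). $T_n$ is the Chebyshev polynomial of the first kind of degree $n$, $T_n(\cos\theta) = \cos(n\theta)$. The Chebyshev coefficients of the first kind of $f$ are $$a_n = \frac{2}{\pi}\int_{-1}^1 \frac{f(x)T_n(x)}{\sqrt{1-x^2}}\,dx, \qquad n \ge 0,$$ so that $f(x) = \frac{a_0}{2} + \sum_{n=1}^\infty a_n T_n(x)$ on $[-1,1]$. *)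

(* Defs.v *)
From Stdlib Require Import Reals.
From Coquelicot Require Import Coquelicot.
Open Scope R_scope.

(* e^{i theta}, by Euler's formula. *)
Definition cis (theta : R) : C := (cos theta, sin theta).

Definition bernstein_ellipse (rho : R) (z : C) : Prop :=
  exists theta : R, 0 <= theta <= 2 * PI /\
    z = (/ 2 * (rho * cis theta + / rho * cis (- theta)))%C.

(* z lies in a bounded path component of the complement of G.  Every path
   [0,1] -> C extends to a path R -> C that is constant outside [0,1], so
   quantifying over functions on R loses nothing. *)
Definition inside (G : C -> Prop) (z : C) : Prop :=
  ~ G z /\
  exists M : R, forall gamma : R -> C,
    (forall t : R, 0 <= t <= 1 -> continuous gamma t) ->
    gamma 0 = z ->
    (forall t : R, 0 <= t <= 1 -> ~ G (gamma t)) ->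
    Cmod (gamma 1) <= M.

(* Expansion in a convergent power series with complex coefficients on a disc
   centred at z. *)
Definition analytic_at (f : C -> C) (z : C) : Prop :=
  exists (c : nat -> C) (r : R), 0 < r /\
    forall w : C, Cmod (w - z)%C < r ->
      is_pseries (K := C_AbsRing) (V := C_NormedModule) c (w - z)%C (f w).

Definition analytic_inside_and_on (G : C -> Prop) (f : C -> C) : Prop :=
  forall z : C, inside G z \/ G z -> analytic_at f z.

Fixpoint chebyshev_T (n : nat) (x : R) : R :=
  match n with
  | O => 1
  | S m => match m with
           | O => x
           | S k => 2 * x * chebyshev_T m x - chebyshev_T k x
           end
  end.

Lemma chebyshev_T_cos (n : nat) (theta : R) :
  chebyshev_T n (cos theta) = cos (INR n * theta).
Proof.
assert (H : chebyshev_T n (cos theta) = cos (INR n * theta) /\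
            chebyshev_T (S n) (cos theta) = cos (INR (S n) * theta)).
{ induction n as [|n [IH1 IH2]].
  - simpl. rewrite Rmult_0_l, cos_0, Rmult_1_l. split; reflexivity.
  - split; [exact IH2|].
    change (chebyshev_T (S (S n)) (cos theta))
      with (2 * cos theta * chebyshev_T (S n) (cos theta)
            - chebyshev_T n (cos theta)).
    rewrite IH1, IH2.
    replace (INR (S (S n)) * theta) with (INR (S n) * theta + theta)
      by (rewrite !S_INR; ring).
    replace (INR n * theta) with (INR (S n) * theta - theta)
      by (rewrite S_INR; ring).
    rewrite cos_plus, cos_minus. ring. }
exact (proj1 H).
Qed.

(* The integrand is singular at -1 and 1, hence an improper integral.
   C is taken as a normed module over the reals, for the Riemann integral of
   functions of a real variable. *)
Definition chebyshev_coeff (f : C -> C) (n : nat) : C :=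
  (2 / PI *
   RInt_gen (V := C_R_CompleteNormedModule)
     (fun x : R => f (RtoC x) * chebyshev_T n x / sqrt (1 - x ^ 2)%R)
     (at_right (-1)) (at_left 1))%C.

(* Main.v *)
Require Import Defs.
From Stdlib Require Import Reals.
From Coquelicot Require Import Coquelicot.
From Stdlib Require Import Lra Lia Ranalysis5 ClassicalEpsilon.
Open Scope R_scope.

(* Let J be the Joukowski map u -> (u + 1/u)/2. It sends the annulus
   1/rho < |u| < rho inside the ellipse, so u -> f(J(u)) / u^n is holomorphic there,
   and its means over the circles |u| = r do not depend on r: by the
   Cauchy-Riemann equations in polar coordinates the r-derivative of the mean is
   the mean of a t-derivative of a periodic function. Uniform continuity on the
   ellipse extends this to r = rho. At r = 1 one has J(e^{it}) = cos t, and folding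
   [0, 2 PI] onto [0, PI] and substituting x = cos t gives the Chebyshev integral. *)

(** * Power series over C *)

(** Differentiating under the integral sign requires a jointly continuous r-derivative, whereas
    [analytic_at] only provides complex power series. The series is therefore differentiated twice:
    the first derivative gives the Cauchy-Riemann equations, the second shows that the first is
    continuous. From there on real and imaginary parts are handled as real functions of two real
    variables. Analyticity on the ellipse gives a disc around each of its points but no common
    radius; reaching r = rho as a limit from smaller radii avoids constructing a larger annulus. For
    r < rho, analyticity at J(u) is available only after the point is shown to be [inside] in the
    path sense, which comes from the implicit equation of the ellipse and the intermediate value
    theorem. J has critical points at u = 1 and u = -1, on the circle r = 1. They do no harm, since
    only the chain rule through J is used and never a local inverse. *)

Lemma is_series_norm_le {K : AbsRing} {V : NormedModule K}
    (a : nat -> V) (b : nat -> R) (l : V) (lb : R) :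
  (forall k, norm (a k) <= b k) -> is_series a l -> is_series b lb -> norm l <= lb.
Proof.
intros Hab Ha Hb.
assert (H : is_lim_seq (fun n => norm (sum_n a n)) (norm l)).
{ eapply filterlim_comp; [exact Ha | exact (filterlim_norm l)]. }
change (Rbar_le (norm l) lb).
apply (is_lim_seq_le (fun n => norm (sum_n a n)) (sum_n b)); [| exact H | exact Hb].
intros n. eapply Rle_trans; [apply norm_sum_n_m|].
apply sum_n_m_le, Hab.
Qed.

Lemma ex_series_bounded {K : AbsRing} {V : NormedModule K} (a : nat -> V) :
  ex_series a -> exists M, 0 < M /\ forall k, norm (a k) <= M.
Proof.
intros [l H].
destruct (filterlim_bounded (sum_n a) (ex_intro _ l H)) as [M HM].
assert (HM0 : 0 <= M) by (exact (Rle_trans _ _ _ (norm_ge_0 (sum_n a 0)) (HM 0%nat))).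
exists (M + M + 1). split; [lra|].
intros [|k].
- specialize (HM 0%nat). rewrite sum_O in HM. lra.
- replace (a (S k)) with (minus (sum_n a (S k)) (sum_n a k)).
  + eapply Rle_trans; [apply norm_triangle|]. rewrite norm_opp.
    pose proof (HM k). pose proof (HM (S k)). lra.
  + rewrite sum_Sn. unfold minus.
    rewrite (plus_comm (sum_n a k)), <- plus_assoc.
    transitivity (plus (a (S k)) zero); [|apply plus_zero_r].
    apply f_equal, (plus_opp_r (G := NormedModule.AbelianGroup K V)).
Qed.

(** Ratio test: consecutive terms have ratio (1 + 1/(k+1))^2 q, which tends to q. This one majorant
    serves both the differentiated series and the second-order Taylor remainders. *)
Lemma ex_series_sqr_geom (q : R) :
  0 < q < 1 -> ex_series (fun k => INR (S k) ^ 2 * q ^ k).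
Proof.
intros Hq.
assert (Hpos : forall k, 0 < INR (S k) ^ 2 * q ^ k).
{ intros k. apply Rmult_lt_0_compat; apply pow_lt; [apply lt_0_INR; lia | lra]. }
apply (ex_series_ext (fun k => Rabs (INR (S k) ^ 2 * q ^ k))).
{ intros k. apply Rabs_pos_eq, Rlt_le, Hpos. }
apply (ex_series_DAlembert _ q); [lra | |].
{ intros k. apply Rgt_not_eq, Hpos. }
apply (is_lim_seq_ext (fun k => (1 + / INR (S k)) * ((1 + / INR (S k)) * q))).
{ intros k.
  assert (0 < INR (S k)) by (apply lt_0_INR; lia).
  assert (0 < q ^ k) by (apply pow_lt; lra).
  rewrite Rabs_pos_eq by (apply Rlt_le, Rdiv_lt_0_compat; apply Hpos).
  rewrite (S_INR (S k)). simpl (q ^ S k). field. split; lra. }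
assert (H : is_lim_seq (fun k => 1 + / INR (S k)) 1).
{ replace (Finite 1) with (Rbar_plus 1 0) by (simpl; f_equal; ring).
  apply is_lim_seq_plus'; [apply is_lim_seq_const|].
  apply (is_lim_seq_incr_1 (fun k => / INR k)).
  change (Finite 0) with (Rbar_inv p_infty).
  apply is_lim_seq_inv; [apply is_lim_seq_INR | discriminate]. }
replace (Finite q) with (Finite (1 * (1 * q))) by (f_equal; ring).
apply is_lim_seq_mult'; [exact H|].
apply is_lim_seq_mult'; [exact H | apply is_lim_seq_const].
Qed.

(** Induction on k: the remainders satisfy R_(k+1) = (w + h) R_k + k w^(k-1) h^2. The factor s^2
    stands on the left so that neither the exponent k - 2 nor a division by s occurs. *)
Lemma Cpow_taylor2 (w h : C) (s : R) (k : nat) :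
  Cmod w <= s -> Cmod (w + h) <= s ->
  Cmod ((w + h) ^ k - w ^ k - INR k * w ^ pred k * h)%C * s ^ 2
    <= INR k ^ 2 * Cmod h ^ 2 * s ^ k.
Proof.
intros Hw Hwh.
assert (Hs : 0 <= s) by (eapply Rle_trans; [apply Cmod_ge_0 | exact Hw]).
induction k as [|k IH].
- replace ((w + h) ^ 0 - w ^ 0 - INR 0 * w ^ pred 0 * h)%C with (RtoC 0)
    by (simpl; ring).
  rewrite Cmod_0. simpl. lra.
- replace ((w + h) ^ S k - w ^ S k - INR (S k) * w ^ pred (S k) * h)%C
    with ((w + h) * ((w + h) ^ k - w ^ k - INR k * w ^ pred k * h)
          + INR k * w ^ pred k * h ^ 2)%C.
  2:{ rewrite S_INR, RtoC_plus. destruct k; simpl pred; rewrite ?Cpow_S; [simpl|]; ring. }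
  eapply Rle_trans.
  { apply Rmult_le_compat_r; [apply pow2_ge_0 | apply Cmod_triangle]. }
  rewrite !Cmod_mult, !Cmod_pow, Cmod_R, (Rabs_pos_eq _ (pos_INR k)).
  set (E := Cmod (_ - _ - _)) in *.
  assert (H1 : Cmod (w + h) * (E * s ^ 2) <= s * (INR k ^ 2 * Cmod h ^ 2 * s ^ k)).
  { apply Rmult_le_compat; auto using Cmod_ge_0.
    apply Rmult_le_pos; [apply Cmod_ge_0 | apply pow2_ge_0]. }
  assert (H2 : INR k * Cmod w ^ pred k * s <= INR k * s ^ k).
  { destruct k as [|k]; [simpl; lra|]. rewrite Rmult_assoc.
    apply Rmult_le_compat_l; [apply pos_INR|]. simpl.
    rewrite (Rmult_comm s). apply Rmult_le_compat_r; [exact Hs|].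
    apply pow_incr. split; [apply Cmod_ge_0 | exact Hw]. }
  assert (H3 : INR k * Cmod w ^ pred k * s * (s * Cmod h ^ 2)
               <= INR k * s ^ k * (s * Cmod h ^ 2)).
  { apply Rmult_le_compat_r; [|exact H2].
    apply Rmult_le_pos; [exact Hs | apply pow2_ge_0]. }
  (* The recurrence yields k^2 + k where (k+1)^2 is allowed; this is the slack k + 1. *)
  assert (H4 : 0 <= (INR k + 1) * (s * s ^ k * Cmod h ^ 2)).
  { apply Rmult_le_pos; [pose proof (pos_INR k); lra|].
    apply Rmult_le_pos; [|apply pow2_ge_0].
    apply Rmult_le_pos; [exact Hs | apply pow_le, Hs]. }
  rewrite S_INR. simpl (s ^ S k). nra.
Qed.

Notation is_Cpseries := (is_pseries (K := C_AbsRing) (V := C_NormedModule)).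

(** Convergence at a real point t with s < t < r bounds |c_k| t^k by some M, and passing from t to s
    leaves the geometric factor q = s/t. *)
Lemma Cpseries_coef_bound (c : nat -> C) (r s : R) (F : C -> C) :
  (forall v, Cmod v < r -> is_Cpseries c v (F v)) -> 0 < s < r ->
  exists M q, 0 < M /\ 0 < q < 1 /\ forall k, Cmod (c k) * s ^ k <= M * q ^ k.
Proof.
intros HF Hs.
set (t := (s + r) / 2).
assert (Ht : s < t < r) by (unfold t; lra).
assert (Hc : Cmod t = t) by (rewrite Cmod_R; apply Rabs_pos_eq; lra).
destruct (ex_series_bounded _ (ex_intro _ _ (HF (RtoC t) ltac:(rewrite Hc; lra))))
  as [M [HM HMk]].
exists M, (s / t). split; [exact HM|]. split.
{ split; [apply Rdiv_lt_0_compat; lra|]. apply Rlt_div_l; lra. }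
intros k. specialize (HMk k).
change (Cmod (Cpow (RtoC t) k * c k)%C <= M) in HMk.
rewrite Cmod_mult, Cmod_pow, Hc in HMk.
replace (s ^ k) with (t ^ k * (s / t) ^ k).
- rewrite <- Rmult_assoc. apply Rmult_le_compat_r; [|lra].
  apply pow_le, Rlt_le, Rdiv_lt_0_compat; lra.
- rewrite <- Rpow_mult_distr. f_equal. field. lra.
Qed.

Definition Cpseries_derive_coef (c : nat -> C) (k : nat) : C := (INR (S k) * c (S k))%C.

(** Comparison at a radius s between |w| and r: the factor k + 1 from differentiation is enlarged to
    its square to reuse the majorant of [ex_series_sqr_geom]. *)
Lemma ex_Cpseries_derive (c : nat -> C) (r : R) (F : C -> C) (w : C) :
  (forall v, Cmod v < r -> is_Cpseries c v (F v)) -> Cmod w < r ->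
  exists d, is_Cpseries (Cpseries_derive_coef c) w d.
Proof.
intros HF Hw.
pose proof (Cmod_ge_0 w) as Hw0.
set (s := (Cmod w + r) / 2).
assert (Hs : Cmod w < s < r) by (unfold s; lra).
destruct (Cpseries_coef_bound c r s F HF ltac:(lra)) as [M [q [HM [Hq HMq]]]].
apply (ex_series_le (V := C_CompleteNormedModule) _
         (fun k => M / s * (INR (S k) ^ 2 * q ^ k))).
2:{ exact (ex_series_scal (K := R_AbsRing) (V := R_NormedModule) (M / s) _
             (ex_series_sqr_geom q Hq)). }
intros k.
change (Cmod (Cpow w k * (INR (S k) * c (S k)))%C <= M / s * (INR (S k) ^ 2 * q ^ k)).
rewrite !Cmod_mult, Cmod_pow, Cmod_R, (Rabs_pos_eq _ (pos_INR (S k))).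
specialize (HMq (S k)). simpl (s ^ S k) in HMq. simpl (q ^ S k) in HMq.
assert (H1 : 1 <= INR (S k)) by (rewrite S_INR; pose proof (pos_INR k); lra).
assert (Hqk : 0 < q ^ k) by (apply pow_lt; lra).
assert (Hwk : Cmod w ^ k <= s ^ k) by (apply pow_incr; lra).
assert (Hc : Cmod (c (S k)) * s ^ k <= M / s * q ^ k).
{ apply (Rmult_le_reg_r s); [lra|].
  replace (M / s * q ^ k * s) with (M * q ^ k) by (field; lra).
  assert (M * (q * q ^ k) <= M * q ^ k) by (apply Rmult_le_compat_l; nra).
  lra. }
assert (Hc' : Cmod w ^ k * Cmod (c (S k)) <= M / s * q ^ k).
{ pose proof (Cmod_ge_0 (c (S k))). nra. }
assert (0 < M / s * q ^ k).
{ apply Rmult_lt_0_compat; [apply Rdiv_lt_0_compat; lra | exact Hqk]. }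
replace (M / s * (INR (S k) ^ 2 * q ^ k)) with (INR (S k) * (INR (S k) * (M / s * q ^ k)))
  by ring.
replace (Cmod w ^ k * (INR (S k) * Cmod (c (S k))))
  with (INR (S k) * (Cmod w ^ k * Cmod (c (S k)))) by ring.
apply Rmult_le_compat_l; nra.
Qed.

(** The bound of [Cpow_taylor2] is summed over k against the coefficients, whose geometric decay at
    radius s absorbs the factor k^2. *)
Lemma Cpseries_taylor2 (c : nat -> C) (r : R) (F D : C -> C) (w : C) :
  (forall v, Cmod v < r -> is_Cpseries c v (F v)) ->
  (forall v, Cmod v < r -> is_Cpseries (Cpseries_derive_coef c) v (D v)) ->
  Cmod w < r ->
  exists K delta, 0 < delta /\ forall h, Cmod h < delta ->
    Cmod (F (w + h) - F w - D w * h)%C <= K * Cmod h ^ 2.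
Proof.
intros HF HD Hw.
pose proof (Cmod_ge_0 w) as Hw0.
set (s := (Cmod w + r) / 2).
assert (Hs : Cmod w < s < r) by (unfold s; lra).
destruct (Cpseries_coef_bound c r s F HF ltac:(lra)) as [M [q [HM [Hq HMq]]]].
destruct (ex_series_sqr_geom q Hq) as [L HL].
(* L is the sum of (k+1)^2 q^k, 1/s^2 comes from [Cpow_taylor2], and the choice of delta keeps w + h
   in the disc of radius s. *)
exists (M / s ^ 2 * L), (s - Cmod w). split; [lra|].
intros h Hh.
assert (Hwh : Cmod (w + h) < s).
{ eapply Rle_lt_trans; [apply Cmod_triangle|]. lra. }
(* The derivative series is shifted by one index to align with that of F; the term added at k = 0
   vanishes because of its factor [INR 0]. *)
assert (HD' : is_series (V := C_NormedModule)
                (fun k => INR k * w ^ pred k * c k)%C (D w)).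
{ apply is_series_decr_1.
  match goal with |- is_series _ ?l => replace l with (D w) end.
  - apply (is_series_ext (V := C_NormedModule) _ _ _) with (2 := HD w Hw).
    intros k.
    change (Cpow w k * (INR (S k) * c (S k)) = INR (S k) * Cpow w k * c (S k))%C. ring.
  - change (D w = D w + - (INR 0 * w ^ 0 * c 0%nat))%C. simpl. ring. }
assert (HT : is_series (V := C_NormedModule)
  (fun k => ((w + h) ^ k - w ^ k - INR k * w ^ pred k * h) * c k)%C
  (F (w + h) - F w - D w * h)%C).
{ pose proof (is_series_minus _ _ _ _
    (is_series_minus _ _ _ _ (HF (w + h)%C ltac:(lra)) (HF w Hw))
    (is_series_scal (K := C_AbsRing) h _ _ HD')) as H.
  match type of H with is_series _ ?l =>
    replace (F (w + h) - F w - D w * h)%C with l end.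
  - revert H. apply is_series_ext. intros k.
    change (Cpow (w + h) k * c k - Cpow w k * c k - h * (INR k * w ^ pred k * c k)
      = ((w + h) ^ k - w ^ k - INR k * w ^ pred k * h) * c k)%C. ring.
  - change (F (w + h) - F w - h * D w = F (w + h) - F w - D w * h)%C. ring. }
pose proof (is_series_scal (K := R_AbsRing) (M / s ^ 2 * Cmod h ^ 2) _ _ HL) as HB.
replace (M / s ^ 2 * L * Cmod h ^ 2) with (scal (M / s ^ 2 * Cmod h ^ 2) L)
  by (unfold scal; simpl; unfold mult; simpl; ring).
apply (is_series_norm_le (V := C_NormedModule)) with (2 := HT) (3 := HB).
intros k. unfold scal; simpl; unfold mult; simpl.
change (Cmod (((w + h) ^ k - w ^ k - INR k * w ^ pred k * h) * c k)%C
  <= M / s ^ 2 * Cmod h ^ 2 * (INR (S k) ^ 2 * q ^ k)).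
rewrite Cmod_mult.
pose proof (Cpow_taylor2 w h s k ltac:(lra) ltac:(lra)) as HE.
set (E := Cmod (_ - _ - _)) in *.
assert (Hs2 : 0 < s ^ 2) by (apply pow_lt; lra).
apply (Rmult_le_reg_r (s ^ 2)); [exact Hs2|].
replace (M / s ^ 2 * Cmod h ^ 2 * (INR (S k) ^ 2 * q ^ k) * s ^ 2)
  with (INR (S k) ^ 2 * Cmod h ^ 2 * (M * q ^ k)) by (field; lra).
assert (Hk : INR k ^ 2 <= INR (S k) ^ 2).
{ apply pow_incr. split; [apply pos_INR | rewrite S_INR; lra]. }
assert (0 <= Cmod h ^ 2) by apply pow2_ge_0.
apply Rle_trans with (INR k ^ 2 * Cmod h ^ 2 * (Cmod (c k) * s ^ k)).
- pose proof (Cmod_ge_0 (c k)). nra.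
- apply Rmult_le_compat.
  + apply Rmult_le_pos; [apply pow2_ge_0 | assumption].
  + apply Rmult_le_pos; [apply Cmod_ge_0 | apply pow_le; lra].
  + apply Rmult_le_compat_r; assumption.
  + apply HMq.
Qed.

(** * Holomorphic functions as planar maps *)

(* The remainder is quadratic rather than o(h) because this is what comparing
   power series term by term gives directly. *)
Definition taylor2_at (f : C -> C) (w d : C) : Prop :=
  exists K delta, 0 < delta /\ forall h, Cmod h < delta ->
    Cmod (f (w + h) - f w - d * h)%C <= K * Cmod h ^ 2.

(** The expansion of D itself is what later makes the partial derivatives of f continuous. *)
Lemma analytic_at_taylor2 (f : C -> C) (z : C) :
  analytic_at f z ->
  exists (D : C -> C) (r : R), 0 < r /\ forall w, Cmod (w - z)%C < r ->
    taylor2_at f w (D w) /\ exists d, taylor2_at D w d.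
Proof.
intros [c [r [Hr Hf]]].
set (F := fun v => f (z + v)%C).
(* A choice operator makes the sum a total function; its value is unspecified where the series
   diverges. *)
set (sum := fun (a : nat -> C) v => epsilon (inhabits (RtoC 0)) (is_Cpseries a v)).
set (D := sum (Cpseries_derive_coef c)).
set (D2 := sum (Cpseries_derive_coef (Cpseries_derive_coef c))).
assert (HF : forall v, Cmod v < r -> is_Cpseries c v (F v)).
{ intros v Hv. specialize (Hf (z + v)%C).
  replace (z + v - z)%C with v in Hf by ring. exact (Hf Hv). }
assert (HD : forall v, Cmod v < r -> is_Cpseries (Cpseries_derive_coef c) v (D v)).
{ intros v Hv. apply epsilon_spec. exact (ex_Cpseries_derive c r F v HF Hv). }
assert (HD2 : forall v, Cmod v < r ->
  is_Cpseries (Cpseries_derive_coef (Cpseries_derive_coef c)) v (D2 v)).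
{ intros v Hv. apply epsilon_spec. exact (ex_Cpseries_derive _ r D v HD Hv). }
exists (fun w => D (w - z)%C), r. split; [exact Hr|].
intros w Hw. split.
- destruct (Cpseries_taylor2 c r F D (w - z)%C HF HD Hw) as [K [delta [Hd H]]].
  exists K, delta. split; [exact Hd|]. intros h Hh. specialize (H h Hh).
  unfold F in H.
  replace (z + (w - z + h))%C with (w + h)%C in H by ring.
  replace (z + (w - z))%C with w in H by ring. exact H.
- exists (D2 (w - z)%C).
  destruct (Cpseries_taylor2 _ r D D2 (w - z)%C HD HD2 Hw) as [K [delta [Hd H]]].
  exists K, delta. split; [exact Hd|]. intros h Hh. specialize (H h Hh).
  replace (w + h - z)%C with (w - z + h)%C by ring. exact H.
Qed.

(** Multiplication by p + iq is the real matrix with rows (p, -q) and (q, p). The two conclusions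
    are its rows, so they contain the Cauchy-Riemann equations. *)
Lemma taylor2_differentiable (f : C -> C) (x y p q : R) :
  taylor2_at f (x, y) (p, q) ->
  differentiable_pt_lim (fun u v => fst (f (u, v))) x y p (- q) /\
  differentiable_pt_lim (fun u v => snd (f (u, v))) x y q p.
Proof.
intros [K [delta [Hdelta H]]].
assert (Hmain : forall eps : posreal, locally_2d (fun u v =>
  Cmod (f (u, v) - f (x, y) - (p, q) * ((u - x)%R, (v - y)%R))%C
    <= eps * Rmax (Rabs (u - x)) (Rabs (v - y))) x y).
{ intros eps.
  assert (HK : 0 < 2 * (Rabs K + 1)) by (pose proof (Rabs_pos K); lra).
  (* With m the max norm of h, |h|^2 <= 2 m^2: the first bound gives |h| < delta, the second turns 2
     (|K| + 1) m^2 into at most eps m. K may have any sign, hence |K| + 1. *)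
  assert (Hd : 0 < Rmin (delta / 2) (eps / (2 * (Rabs K + 1)))).
  { apply Rmin_pos; [lra|]. apply Rdiv_lt_0_compat; [apply cond_pos | exact HK]. }
  exists (mkposreal _ Hd). simpl. intros u v Hu Hv.
  set (m := Rmax (Rabs (u - x)) (Rabs (v - y))).
  assert (Hm : m < Rmin (delta / 2) (eps / (2 * (Rabs K + 1)))) by (apply Rmax_lub_lt; assumption).
  assert (Hm0 : 0 <= m) by (eapply Rle_trans; [apply Rabs_pos | apply Rmax_l]).
  pose proof (Rmin_l (delta / 2) (eps / (2 * (Rabs K + 1)))).
  pose proof (Rmin_r (delta / 2) (eps / (2 * (Rabs K + 1)))).
  assert (Hme : m * (2 * (Rabs K + 1)) <= eps).
  { apply Rle_div_r; [exact HK | lra]. }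
  assert (Hh2 : Cmod (u - x, v - y) ^ 2 <= 2 * m ^ 2).
  { unfold Cmod. rewrite pow2_sqrt by (apply Rplus_le_le_0_compat; apply pow2_ge_0).
    simpl fst; simpl snd.
    assert (forall t, Rabs t <= m -> t ^ 2 <= m ^ 2) as Hsq.
    { intros t Ht. rewrite <- (pow2_abs t). apply pow_incr.
      split; [apply Rabs_pos | exact Ht]. }
    pose proof (Hsq _ (Rmax_l (Rabs (u - x)) (Rabs (v - y)))).
    pose proof (Hsq _ (Rmax_r (Rabs (u - x)) (Rabs (v - y)))). lra. }
  assert (Hh : Cmod (u - x, v - y) < delta).
  { pose proof (Cmod_ge_0 (u - x, v - y)). nra. }
  specialize (H _ Hh).
  replace ((x, y) + ((u - x)%R, (v - y)%R))%C with ((u, v) : C) in H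
    by (unfold Cplus; simpl; f_equal; ring).
  eapply Rle_trans; [exact H|].
  pose proof (Rle_abs K). pose proof (Rabs_pos K).
  pose proof (pow2_ge_0 (Cmod (u - x, v - y))).
  apply Rle_trans with ((Rabs K + 1) * (2 * m ^ 2)); nra. }
split; intros eps; destruct (Hmain eps) as [d Hd]; exists d; intros u v Hu Hv;
  (eapply Rle_trans; [|exact (Hd u v Hu Hv)]).
- match goal with |- Rabs ?r <= Cmod ?z => replace r with (fst z) by (simpl; ring) end.
  eapply Rle_trans; [apply Rmax_l | apply Rmax_Cmod].
- match goal with |- Rabs ?r <= Cmod ?z => replace r with (snd z) by (simpl; ring) end.
  eapply Rle_trans; [apply Rmax_r | apply Rmax_Cmod].
Qed.

Definition re_part (f : C -> C) (x y : R) : R := fst (f (x, y)).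
Definition im_part (f : C -> C) (x y : R) : R := snd (f (x, y)).
(** [re_deriv] and [im_deriv] are the two parts of the complex derivative f'. Derivatives in x
    suffice, those in y being given by the Cauchy-Riemann equations. *)
Definition re_deriv (f : C -> C) (x y : R) : R := Derive (fun u => re_part f u y) x.
Definition im_deriv (f : C -> C) (x y : R) : R := Derive (fun u => im_part f u y) x.

Lemma differentiable_continuity_2d (g : R -> R -> R) (x y lx ly : R) :
  differentiable_pt_lim g x y lx ly -> continuity_2d_pt g x y.
Proof. intros H. apply differentiable_continuity_pt. now exists lx, ly. Qed.

Lemma differentiable_Derive_fst (g : R -> R -> R) (x y lx ly : R) :
  differentiable_pt_lim g x y lx ly -> Derive (fun u => g u y) x = lx.
Proof.
intros H. apply is_derive_unique, is_derive_Reals.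
replace lx with (lx * 1 + ly * 0) by ring.
apply (derivable_pt_lim_comp_2d g (fun u => u) (fun _ => y)); [exact H| |].
- apply derivable_pt_lim_id.
- apply derivable_pt_lim_const.
Qed.

(** The Cauchy-Riemann equations are built into the second coefficients of the two differentials. *)
Record C1_holomorphic_at (f : C -> C) (x y : R) : Prop := {
  C1_re : differentiable_pt_lim (re_part f) x y (re_deriv f x y) (- im_deriv f x y);
  C1_im : differentiable_pt_lim (im_part f) x y (im_deriv f x y) (re_deriv f x y);
  C1_re_cont : continuity_2d_pt (re_deriv f) x y;
  C1_im_cont : continuity_2d_pt (im_deriv f) x y }.

(** Near the point D has parts [re_deriv] and [im_deriv]; being differentiable at the point, D is
    continuous there, and so are they. *)
Lemma analytic_at_C1 (f : C -> C) (x y : R) :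
  analytic_at f (x, y) -> C1_holomorphic_at f x y.
Proof.
intros Hf. destruct (analytic_at_taylor2 f (x, y) Hf) as [D [r [Hr H]]].
assert (Hloc : forall u v, Cmod ((u, v) - (x, y))%C < r ->
  differentiable_pt_lim (re_part f) u v (fst (D (u, v))) (- snd (D (u, v))) /\
  differentiable_pt_lim (im_part f) u v (snd (D (u, v))) (fst (D (u, v)))).
{ intros u v Huv. apply taylor2_differentiable.
  rewrite <- surjective_pairing. apply H, Huv. }
assert (Heq : locally_2d (fun u v =>
  fst (D (u, v)) = re_deriv f u v /\ snd (D (u, v)) = im_deriv f u v) x y).
(* Half the radius suffices since the modulus is at most sqrt 2 < 2 times the max norm. *)
{ assert (Hr2 : 0 < r / 2) by lra.
  exists (mkposreal _ Hr2). simpl. intros u v Hu Hv.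
  destruct (Hloc u v) as [H1 H2].
  { eapply Rle_lt_trans; [apply Cmod_2Rmax|]. simpl.
    assert (sqrt 2 < 2).
    { rewrite <- (sqrt_pow2 2) at 2 by lra. apply sqrt_lt_1; lra. }
    assert (Rmax (Rabs (u + - x)) (Rabs (v + - y)) < r / 2) by (apply Rmax_lub_lt; assumption).
    pose proof (Rabs_pos (u + - x)). pose proof (Rmax_l (Rabs (u + - x)) (Rabs (v + - y))).
    pose proof (sqrt_pos 2). nra. }
  split; symmetry; eapply differentiable_Derive_fst; eassumption. }
assert (Hxy : Cmod ((x, y) - (x, y))%C < r).
{ replace ((x, y) - (x, y))%C with (RtoC 0) by ring. now rewrite Cmod_0. }
destruct (Hloc x y Hxy) as [H1 H2].
destruct (locally_2d_singleton _ _ _ Heq) as [E1 E2].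
destruct (H _ Hxy) as [_ [d Hd]].
rewrite (surjective_pairing d) in Hd.
apply taylor2_differentiable in Hd. destruct Hd as [Hd1 Hd2].
split.
- now rewrite <- E1, <- E2.
- now rewrite <- E1, <- E2.
- apply (continuity_2d_pt_ext_loc (fun u v => fst (D (u, v)))).
  + revert Heq. apply locally_2d_impl, locally_2d_forall. tauto.
  + eapply differentiable_continuity_2d, Hd1.
- apply (continuity_2d_pt_ext_loc (fun u v => snd (D (u, v)))).
  + revert Heq. apply locally_2d_impl, locally_2d_forall. tauto.
  + eapply differentiable_continuity_2d, Hd2.
Qed.

(** Stated for an abstract pair so that it applies both to (Re, Im) and to (Im, -Re). *)
Lemma is_derive_RInt_conjugate_zero (P Q dP : R -> R -> R) (a b r0 r1 r : R) :
  0 < r0 -> r0 < r < r1 ->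
  (forall s t, r0 < s < r1 -> is_derive (fun u => P u t) s (dP s t)) ->
  (forall s t, r0 < s < r1 -> is_derive (Q s) t (s * dP s t)) ->
  (forall s t, r0 < s < r1 -> continuity_2d_pt dP s t) ->
  (forall s t, r0 < s < r1 -> continuous (P s) t) ->
  Q r a = Q r b ->
  is_derive (fun s => RInt (P s) a b) r 0.
Proof.
intros H0 Hr HP HQ HdP HPc Hper.
assert (Hloc : locally r (fun s => r0 < s < r1)).
{ apply (locally_interval _ r r0 r1); simpl; tauto. }
assert (HD : forall s t, r0 < s < r1 -> Derive (fun u => P u t) s = dP s t).
{ intros s t Hs. apply is_derive_unique, HP, Hs. }
replace 0 with (RInt (fun t => Derive (fun u => P u t) r) a b).
- apply (is_derive_RInt_param P).
  + apply filter_imp with (2 := Hloc). intros s Hs t _. exists (dP s t). now apply HP.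
  + intros t _. apply (continuity_2d_pt_ext_loc dP).
    * destruct Hloc as [d Hd]. exists d. intros u v Hu _. symmetry. apply HD, Hd, Hu.
    * now apply HdP.
  + apply filter_imp with (2 := Hloc). intros s Hs.
    apply (ex_RInt_continuous (V := R_CompleteNormedModule)). intros t _. now apply HPc.
- rewrite (RInt_ext _ (fun t => / r * (r * dP r t))).
  2:{ intros t _. rewrite HD by exact Hr. change (dP r t = / r * (r * dP r t)). field. lra. }
  rewrite (is_RInt_unique _ _ _ (scal (/ r) (minus (Q r b) (Q r a)))).
  + change (/ r * (Q r b - Q r a) = 0). rewrite Hper. ring.
  + apply (is_RInt_scal (fun t => r * dP r t)).
    apply (is_RInt_derive (Q r)).
    * intros t _. now apply HQ.
    * intros t _. apply (continuous_mult (K := R_AbsRing)); [apply continuous_const|].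
      pose proof (HdP r t Hr) as Hc. apply continuity_2d_pt_filterlim in Hc.
      apply (continuous_comp_2 (fun _ => r) (fun t => t) dP).
      -- apply continuous_const.
      -- apply continuous_id.
      -- exact Hc.
Qed.

(** * The Joukowski map in polar coordinates *)

Definition joukowski_x (r t : R) : R := / 2 * (r + / r) * cos t.
Definition joukowski_y (r t : R) : R := / 2 * (r - / r) * sin t.

Lemma joukowski_cis (r t : R) : r <> 0 ->
  (/ 2 * (r * cis t + / (r * cis t)))%C = (joukowski_x r t, joukowski_y r t).
Proof.
intros Hr.
assert (Ht : Rsqr (sin t) + Rsqr (cos t) = 1) by apply sin2_cos2. unfold Rsqr in Ht.
assert (Hinv : (/ (r * cis t))%C = (/ r * cos t, - / r * sin t)).
{ assert (Hm : ((r * cis t) * (/ r * cos t, - / r * sin t)%R = 1)%C).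
  { unfold Cmult, cis, RtoC; simpl. f_equal.
    - transitivity (sin t * sin t + cos t * cos t); [field; exact Hr | exact Ht].
    - field. exact Hr. }
  assert (Hnz : (r * cis t)%C <> 0).
  { intros E. rewrite E, Cmult_0_l in Hm. apply (f_equal fst) in Hm. simpl in Hm. lra. }
  transitivity ((/ (r * cis t)) * ((r * cis t) * (/ r * cos t, - / r * sin t)%R))%C.
  - rewrite Hm. ring.
  - rewrite Cmult_assoc, Cinv_l by exact Hnz. ring. }
rewrite Hinv.
replace (/ 2)%C with (RtoC (/ 2)) by (rewrite RtoC_inv; [reflexivity | lra]).
unfold joukowski_x, joukowski_y, Cmult, Cplus, cis, RtoC; simpl.
f_equal; ring.
Qed.

(* Real and imaginary parts of [f (J u) / u ^ n] at [u = r e^{i t}], [J] being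
   the Joukowski map. *)
Definition polar_re (f : C -> C) (n : nat) (r t : R) : R :=
  (/ r) ^ n * (re_part f (joukowski_x r t) (joukowski_y r t) * cos (INR n * t)
             + im_part f (joukowski_x r t) (joukowski_y r t) * sin (INR n * t)).
Definition polar_im (f : C -> C) (n : nat) (r t : R) : R :=
  (/ r) ^ n * (im_part f (joukowski_x r t) (joukowski_y r t) * cos (INR n * t)
             - re_part f (joukowski_x r t) (joukowski_y r t) * sin (INR n * t)).

Definition joukowski_x_dr (r t : R) : R := / 2 * (1 - / r ^ 2) * cos t.
Definition joukowski_y_dr (r t : R) : R := / 2 * (1 + / r ^ 2) * sin t.
(** [comp_re_dr] and [comp_im_dr] are the real and imaginary parts of the product of f'(J) with the
    r-derivative of J. *)
Definition comp_re_dr (f : C -> C) (r t : R) : R :=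
  re_deriv f (joukowski_x r t) (joukowski_y r t) * joukowski_x_dr r t
  - im_deriv f (joukowski_x r t) (joukowski_y r t) * joukowski_y_dr r t.
Definition comp_im_dr (f : C -> C) (r t : R) : R :=
  im_deriv f (joukowski_x r t) (joukowski_y r t) * joukowski_x_dr r t
  + re_deriv f (joukowski_x r t) (joukowski_y r t) * joukowski_y_dr r t.
Definition polar_re_dr (f : C -> C) (n : nat) (r t : R) : R :=
  (/ r) ^ n * (comp_re_dr f r t * cos (INR n * t) + comp_im_dr f r t * sin (INR n * t))
  - INR n * / r * polar_re f n r t.
Definition polar_im_dr (f : C -> C) (n : nat) (r t : R) : R :=
  (/ r) ^ n * (comp_im_dr f r t * cos (INR n * t) - comp_re_dr f r t * sin (INR n * t))
  - INR n * / r * polar_im f n r t.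

Lemma is_derive_inv_pow (n : nat) (r : R) : r <> 0 ->
  is_derive (fun s => (/ s) ^ n) r (- (INR n * / r * (/ r) ^ n)).
Proof.
intros Hr. auto_derive; [exact Hr|].
destruct n as [|m]; [simpl; ring|].
simpl pred. rewrite <- tech_pow_Rmult. field. exact Hr.
Qed.

Lemma is_derive_comp_2d (g : R -> R -> R) (x y : R -> R) (s lx ly dx dy l : R) :
  differentiable_pt_lim g (x s) (y s) lx ly ->
  is_derive x s dx -> is_derive y s dy -> l = lx * dx + ly * dy ->
  is_derive (fun u => g (x u) (y u)) s l.
Proof.
intros Hg Hx Hy ->. apply is_derive_Reals.
apply derivable_pt_lim_comp_2d; [exact Hg | now apply is_derive_Reals ..].
Qed.

Lemma is_derive_joukowski_r (r t : R) : r <> 0 ->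
  is_derive (fun s => joukowski_x s t) r (joukowski_x_dr r t) /\
  is_derive (fun s => joukowski_y s t) r (joukowski_y_dr r t).
Proof.
intros Hr. unfold joukowski_x, joukowski_x_dr, joukowski_y, joukowski_y_dr.
split; (auto_derive; [auto|]); field; auto.
Qed.

(** J is holomorphic in u = r e^{it}, so its t-derivative is i r times its r-derivative. *)
Lemma is_derive_joukowski_t (r t : R) : r <> 0 ->
  is_derive (joukowski_x r) t (- (r * joukowski_y_dr r t)) /\
  is_derive (joukowski_y r) t (r * joukowski_x_dr r t).
Proof.
intros Hr. unfold joukowski_x, joukowski_x_dr, joukowski_y, joukowski_y_dr.
split; (auto_derive; [auto|]); field; auto.
Qed.

Lemma is_derive_comp_r (f : C -> C) (r t : R) : r <> 0 ->
  C1_holomorphic_at f (joukowski_x r t) (joukowski_y r t) ->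
  is_derive (fun s => re_part f (joukowski_x s t) (joukowski_y s t)) r (comp_re_dr f r t) /\
  is_derive (fun s => im_part f (joukowski_x s t) (joukowski_y s t)) r (comp_im_dr f r t).
Proof.
intros Hr [Hre Him _ _]. destruct (is_derive_joukowski_r r t Hr) as [Hx Hy].
split.
- eapply (is_derive_comp_2d (re_part f) (fun s => joukowski_x s t) (fun s => joukowski_y s t));
    [exact Hre | exact Hx | exact Hy | unfold comp_re_dr; ring].
- eapply (is_derive_comp_2d (im_part f) (fun s => joukowski_x s t) (fun s => joukowski_y s t));
    [exact Him | exact Hx | exact Hy | unfold comp_im_dr; ring].
Qed.

Lemma is_derive_comp_t (f : C -> C) (r t : R) : r <> 0 ->
  C1_holomorphic_at f (joukowski_x r t) (joukowski_y r t) ->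
  is_derive (fun s => re_part f (joukowski_x r s) (joukowski_y r s)) t
    (- (r * comp_im_dr f r t)) /\
  is_derive (fun s => im_part f (joukowski_x r s) (joukowski_y r s)) t
    (r * comp_re_dr f r t).
Proof.
intros Hr [Hre Him _ _]. destruct (is_derive_joukowski_t r t Hr) as [Hx Hy].
split.
- eapply (is_derive_comp_2d (re_part f) (joukowski_x r) (joukowski_y r));
    [exact Hre | exact Hx | exact Hy | unfold comp_im_dr; ring].
- eapply (is_derive_comp_2d (im_part f) (joukowski_x r) (joukowski_y r));
    [exact Him | exact Hx | exact Hy | unfold comp_re_dr; ring].
Qed.

(** One product rule covers both parts of f(J(u)) / u^n and both polar variables; only the roles of
    constant and varying factors change. *)
Lemma is_derive_mult_sum (a U V c d : R -> R) (s a' U' V' c' d' l : R) :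
  is_derive a s a' -> is_derive U s U' -> is_derive V s V' ->
  is_derive c s c' -> is_derive d s d' ->
  l = a' * (U s * c s + V s * d s) + a s * (U' * c s + U s * c' + (V' * d s + V s * d')) ->
  is_derive (fun u => a u * (U u * c u + V u * d u)) s l.
Proof.
intros Ha HU HV Hc Hd ->.
auto_derive; [repeat split; eexists; eassumption|].
apply is_derive_unique in Ha, HU, HV, Hc, Hd.
change (fun x => a x) with a. change (fun x => U x) with U. change (fun x => V x) with V.
change (fun x => c x) with c. change (fun x => d x) with d.
rewrite Ha, HU, HV, Hc, Hd. ring.
Qed.

(** Moving the sign onto the sine gives the shape that [is_derive_mult_sum] accepts. *)
Lemma polar_imE (f : C -> C) (n : nat) (r t : R) :
  polar_im f n r t =
  (/ r) ^ n * (im_part f (joukowski_x r t) (joukowski_y r t) * cos (INR n * t)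
             + re_part f (joukowski_x r t) (joukowski_y r t) * - sin (INR n * t)).
Proof. unfold polar_im. ring. Qed.

Lemma is_derive_polar_r (f : C -> C) (n : nat) (r t : R) : r <> 0 ->
  C1_holomorphic_at f (joukowski_x r t) (joukowski_y r t) ->
  is_derive (fun s => polar_re f n s t) r (polar_re_dr f n r t) /\
  is_derive (fun s => polar_im f n s t) r (polar_im_dr f n r t).
Proof.
intros Hr Hf. destruct (is_derive_comp_r f r t Hr Hf) as [HU HV].
pose proof (is_derive_inv_pow n r Hr) as Ha.
assert (Hconst : forall k : R, is_derive (fun _ : R => k) r 0) by (intros k; apply (is_derive_const k)).
split.
- apply (is_derive_mult_sum (fun s => (/ s) ^ n) _ _ (fun _ => cos (INR n * t))
    (fun _ => sin (INR n * t)))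
    with (1 := Ha) (2 := HU) (3 := HV) (4 := Hconst _) (5 := Hconst _).
  unfold polar_re_dr, polar_re. ring.
- apply (is_derive_ext _ _ _ _ (fun s => eq_sym (polar_imE f n s t))).
  apply (is_derive_mult_sum (fun s => (/ s) ^ n) _ _ (fun _ => cos (INR n * t))
    (fun _ => - sin (INR n * t)))
    with (1 := Ha) (2 := HV) (3 := HU) (4 := Hconst _) (5 := Hconst _).
  unfold polar_im_dr, polar_im. ring.
Qed.

(* Together with [is_derive_polar_r], the Cauchy-Riemann equations in polar
   coordinates. *)
Lemma is_derive_polar_t (f : C -> C) (n : nat) (r t : R) : r <> 0 ->
  C1_holomorphic_at f (joukowski_x r t) (joukowski_y r t) ->
  is_derive (polar_re f n r) t (- (r * polar_im_dr f n r t)) /\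
  is_derive (polar_im f n r) t (r * polar_re_dr f n r t).
Proof.
intros Hr Hf. destruct (is_derive_comp_t f r t Hr Hf) as [HU HV].
assert (Ha : is_derive (fun _ : R => (/ r) ^ n) t 0) by apply (is_derive_const ((/ r) ^ n)).
assert (Hc : is_derive (fun s => cos (INR n * s)) t (- (INR n * sin (INR n * t)))).
{ auto_derive; [exact I | ring]. }
assert (Hs : is_derive (fun s => sin (INR n * s)) t (INR n * cos (INR n * t))).
{ auto_derive; [exact I | ring]. }
assert (Hs' : is_derive (fun s => - sin (INR n * s)) t (- (INR n * cos (INR n * t)))).
{ auto_derive; [exact I | ring]. }
split.
- apply (is_derive_mult_sum (fun _ => (/ r) ^ n))
    with (1 := Ha) (2 := HU) (3 := HV) (4 := Hc) (5 := Hs).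
  unfold polar_im_dr, polar_im. field. exact Hr.
- apply (is_derive_ext _ _ _ _ (fun s => eq_sym (polar_imE f n r s))).
  apply (is_derive_mult_sum (fun _ => (/ r) ^ n))
    with (1 := Ha) (2 := HV) (3 := HU) (4 := Hc) (5 := Hs').
  unfold polar_re_dr, polar_re. field. exact Hr.
Qed.

Lemma continuous_R_mult {T : UniformSpace} (f g : T -> R) (x : T) :
  continuous f x -> continuous g x -> continuous (fun y => f y * g y) x.
Proof. exact (continuous_mult (K := R_AbsRing) f g x). Qed.

Lemma continuous_R_plus {T : UniformSpace} (f g : T -> R) (x : T) :
  continuous f x -> continuous g x -> continuous (fun y => f y + g y) x.
Proof. exact (continuous_plus (K := R_AbsRing) (V := R_NormedModule) f g x). Qed.

Lemma continuous_R_minus {T : UniformSpace} (f g : T -> R) (x : T) :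
  continuous f x -> continuous g x -> continuous (fun y => f y - g y) x.
Proof. exact (continuous_minus (K := R_AbsRing) (V := R_NormedModule) f g x). Qed.

Lemma continuous_R_comp {T : UniformSpace} (g : R -> R) (f : T -> R) (x : T) :
  continuous f x -> ex_derive g (f x) -> continuous (fun y => g (f y)) x.
Proof.
intros Hf Hg. apply continuous_comp; [exact Hf|].
exact (ex_derive_continuous (K := R_AbsRing) (V := R_NormedModule) g _ Hg).
Qed.

Ltac continuity_R :=
  repeat first
    [ assumption
    | apply continuous_const
    | apply continuous_fst
    | apply continuous_snd
    | apply continuous_id
    | apply continuous_R_mult
    | apply continuous_R_minus
    | apply continuous_R_plus
    | match goal with
      | |- continuous (fun z => cos _) _ => apply (continuous_R_comp cos)
      | |- continuous (fun z => sin _) _ => apply (continuous_R_comp sin)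
      | |- continuous (fun z => / _) _ => apply (continuous_R_comp Rinv)
      | |- continuous (fun z => _ ^ ?n) _ => apply (continuous_R_comp (fun y => pow y n))
      end ].

Lemma continuity_polar (f : C -> C) (n : nat) (r t : R) : r <> 0 ->
  C1_holomorphic_at f (joukowski_x r t) (joukowski_y r t) ->
  continuity_2d_pt (polar_re f n) r t /\ continuity_2d_pt (polar_im f n) r t /\
  continuity_2d_pt (polar_re_dr f n) r t /\ continuity_2d_pt (polar_im_dr f n) r t.
Proof.
intros Hr [Hre Him Cre Cim].
apply differentiable_continuity_2d in Hre. apply differentiable_continuity_2d in Him.
assert (Hcos : forall s : R, ex_derive cos s) by (intros s; auto_derive; exact I).
assert (Hsin : forall s : R, ex_derive sin s) by (intros s; auto_derive; exact I).
assert (Hinv : ex_derive Rinv r) by (auto_derive; exact Hr).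
assert (Hpow : forall s, ex_derive (fun y => pow y n) s) by (intros s; auto_derive; exact I).
assert (Hinv2 : ex_derive Rinv (r ^ 2)) by (auto_derive; now apply pow_nonzero).
assert (Hsq : forall s, ex_derive (fun y => pow y 2) s) by (intros s; auto_derive; exact I).
assert (Hx : continuous (fun z : R * R => joukowski_x (fst z) (snd z)) (r, t)).
{ unfold joukowski_x. continuity_R; auto. }
assert (Hy : continuous (fun z : R * R => joukowski_y (fst z) (snd z)) (r, t)).
{ unfold joukowski_y. continuity_R; auto. }
assert (Hxdr : continuous (fun z : R * R => joukowski_x_dr (fst z) (snd z)) (r, t)).
{ unfold joukowski_x_dr. continuity_R; auto. }
assert (Hydr : continuous (fun z : R * R => joukowski_y_dr (fst z) (snd z)) (r, t)).
{ unfold joukowski_y_dr. continuity_R; auto. }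
assert (Hcomp : forall g : R -> R -> R,
  continuity_2d_pt g (joukowski_x r t) (joukowski_y r t) ->
  continuous (fun z : R * R => g (joukowski_x (fst z) (snd z)) (joukowski_y (fst z) (snd z)))
    (r, t)).
{ intros g Hg. apply continuity_2d_pt_filterlim in Hg.
  apply (continuous_comp_2 (fun z : R * R => joukowski_x (fst z) (snd z))
    (fun z : R * R => joukowski_y (fst z) (snd z)) g); assumption. }
apply Hcomp in Hre. apply Hcomp in Him. apply Hcomp in Cre. apply Hcomp in Cim.
assert (HP : continuous (fun z : R * R => polar_re f n (fst z) (snd z)) (r, t)).
{ unfold polar_re. continuity_R; auto. }
assert (HQ : continuous (fun z : R * R => polar_im f n (fst z) (snd z)) (r, t)).
{ unfold polar_im. continuity_R; auto. }
repeat split; apply continuity_2d_pt_filterlim.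
- exact HP.
- exact HQ.
- change (continuous (fun z : R * R => polar_re_dr f n (fst z) (snd z)) (r, t)).
  unfold polar_re_dr, comp_re_dr, comp_im_dr. continuity_R; auto.
- change (continuous (fun z : R * R => polar_im_dr f n (fst z) (snd z)) (r, t)).
  unfold polar_im_dr, comp_re_dr, comp_im_dr. continuity_R; auto.
Qed.

(** * The interior of the ellipse *)

Lemma bernstein_ellipse_joukowski (rho x y : R) : rho <> 0 ->
  bernstein_ellipse rho (x, y) <->
  exists t, 0 <= t <= 2 * PI /\ x = joukowski_x rho t /\ y = joukowski_y rho t.
Proof.
intros Hrho.
assert (E : forall t, (/ 2 * (rho * cis t + / rho * cis (- t)))%C
  = (joukowski_x rho t, joukowski_y rho t)).
{ intros t.
  replace (/ 2)%C with (RtoC (/ 2)) by (rewrite RtoC_inv; [reflexivity | lra]).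
  rewrite <- RtoC_inv by exact Hrho.
  unfold joukowski_x, joukowski_y, cis, Cmult, Cplus, RtoC; simpl.
  rewrite cos_neg, sin_neg. f_equal; ring. }
split; intros [t [Ht Hxy]]; exists t; (split; [exact Ht|]).
- rewrite E in Hxy. injection Hxy as -> ->. split; reflexivity.
- rewrite E. destruct Hxy as [-> ->]. reflexivity.
Qed.

Lemma unit_circle_angle (x y : R) : x ^ 2 + y ^ 2 = 1 ->
  exists t, 0 <= t <= 2 * PI /\ x = cos t /\ y = sin t.
Proof.
intros H.
assert (Hx : -1 <= x <= 1) by (split; nra).
pose proof (acos_bound x) as Hb.
assert (Hs : sin (acos x) = Rabs y).
{ rewrite sin_acos by exact Hx. rewrite <- sqrt_Rsqr_abs. f_equal. unfold Rsqr. lra. }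
destruct (Rle_dec 0 y) as [Hy|Hy].
- exists (acos x). rewrite Hs, cos_acos by exact Hx.
  rewrite Rabs_pos_eq by exact Hy. repeat split; lra.
(* On the lower half circle the angle in [0, 2 PI] is 2 PI - acos x, written in the form that
   [cos_period] rewrites. *)
- exists (- acos x + 2 * INR 1 * PI).
  rewrite cos_period, sin_period, cos_neg, sin_neg, Hs, cos_acos by exact Hx.
  rewrite Rabs_left by lra. simpl. repeat split; lra.
Qed.

(** The implicit equation turns avoiding the ellipse into a condition on one continuous real
    function, to which the intermediate value theorem applies. *)
Definition ellipse_level (rho : R) (z : C) : R :=
  (fst z / (/ 2 * (rho + / rho))) ^ 2 + (snd z / (/ 2 * (rho - / rho))) ^ 2.

Lemma semi_axes_pos (rho : R) : 1 < rho -> 0 < / 2 * (rho + / rho) /\ 0 < / 2 * (rho - / rho).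
Proof.
intros Hrho.
assert (0 < / rho < 1).
{ split; [apply Rinv_0_lt_compat; lra|]. rewrite <- Rinv_1. apply Rinv_lt_contravar; lra. }
lra.
Qed.

Lemma ellipse_level_1 (rho : R) (z : C) : 1 < rho ->
  bernstein_ellipse rho z <-> ellipse_level rho z = 1.
Proof.
intros Hrho. destruct (semi_axes_pos rho Hrho) as [Ha Hb]. destruct z as [x y].
rewrite bernstein_ellipse_joukowski by lra.
unfold ellipse_level, joukowski_x, joukowski_y. simpl fst; simpl snd.
set (a := / 2 * (rho + / rho)) in *. set (b := / 2 * (rho - / rho)) in *.
split.
- intros [t [_ [-> ->]]].
  replace (a * cos t / a) with (cos t) by (field; lra).
  replace (b * sin t / b) with (sin t) by (field; lra).
  rewrite <- (sin2_cos2 t). unfold Rsqr. ring.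
- intros H. destruct (unit_circle_angle _ _ H) as [t [Ht [Hx Hy]]].
  exists t. split; [exact Ht|]. rewrite <- Hx, <- Hy. split; field; lra.
Qed.

(* A path leaving the region [ellipse_level <= 1] crosses the ellipse. *)
Lemma ellipse_level_lt1_inside (rho : R) (z : C) : 1 < rho ->
  ellipse_level rho z < 1 -> inside (bernstein_ellipse rho) z.
Proof.
intros Hrho Hz. destruct (semi_axes_pos rho Hrho) as [Ha Hb].
split.
{ rewrite ellipse_level_1 by exact Hrho. lra. }
(* Both coordinates are bounded by the major semi-axis; sqrt 2 passes from the max norm to the
   modulus. *)
exists (sqrt 2 * (/ 2 * (rho + / rho))).
intros gamma Hc H0 Hav.
assert (Hle : ellipse_level rho (gamma 1) <= 1).
{ apply Rnot_lt_le. intros H1.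
  destruct (IVT_interv (fun t => ellipse_level rho (gamma t) - 1) 0 1) as [t [Ht Ht1]].
  - intros t Ht. apply continuity_pt_filterlim.
    assert (Hx : continuous (fun s => fst (gamma s)) t).
    { apply (continuous_comp gamma (fun z : C => fst z)); [now apply Hc | apply continuous_fst]. }
    assert (Hy : continuous (fun s => snd (gamma s)) t).
    { apply (continuous_comp gamma (fun z : C => snd z)); [now apply Hc | apply continuous_snd]. }
    change (continuous (fun s => ellipse_level rho (gamma s) - 1) t).
    assert (Hsq : forall s, ex_derive (fun y => pow y 2) s) by (intros s; auto_derive; exact I).
    unfold ellipse_level, Rdiv. continuity_R; auto.
  - lra.
  - rewrite H0. lra.
  - lra.
  - apply (Hav t Ht). apply ellipse_level_1; [exact Hrho | lra]. }
unfold ellipse_level in Hle. destruct (gamma 1) as [x y]. simpl fst in Hle; simpl snd in Hle.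
eapply Rle_trans; [apply Cmod_2Rmax|].
apply Rmult_le_compat_l; [apply sqrt_pos|]. simpl.
assert (Hrinv : 0 < / rho) by (apply Rinv_0_lt_compat; lra).
set (a := / 2 * (rho + / rho)) in *. set (b := / 2 * (rho - / rho)) in *.
assert (Habs : forall u c, 0 < c -> (u / c) ^ 2 <= 1 -> Rabs u <= c).
{ intros u c Hc1 Hu.
  assert (Hu2 : u ^ 2 <= c ^ 2).
  { replace (u ^ 2) with ((u / c) ^ 2 * c ^ 2) by (field; lra).
    pose proof (pow2_ge_0 c). nra. }
  apply Rabs_le. split; nra. }
apply Rmax_lub.
- apply Habs; [exact Ha|]. pose proof (pow2_ge_0 (y / b)). lra.
- apply Rle_trans with b; [|unfold a, b; lra].
  apply Habs; [exact Hb|]. pose proof (pow2_ge_0 (x / a)). lra.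
Qed.

(** The image of the circle of radius r is a confocal ellipse with smaller semi-axes (degenerate at
    r = 1), so the level is A cos^2 t + B sin^2 t with A, B < 1. *)
Lemma joukowski_inside (rho r t : R) : 1 < rho -> / rho < r < rho ->
  inside (bernstein_ellipse rho) (joukowski_x r t, joukowski_y r t).
Proof.
intros Hrho Hr. apply ellipse_level_lt1_inside; [exact Hrho|].
destruct (semi_axes_pos rho Hrho) as [Ha Hb].
assert (Hrinv : 0 < / rho) by (apply Rinv_0_lt_compat; lra).
assert (Hr' : / rho < / r < rho).
{ split; [apply Rinv_lt_contravar; nra|].
  rewrite <- (Rinv_inv rho). apply Rinv_lt_contravar; nra. }
assert (Hsum : r + / r < rho + / rho).
{ assert (E : rho + / rho - (r + / r) = (rho - r) * (1 - / rho * / r)) by (field; lra).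
  assert (/ rho * / r < 1).
  { rewrite <- (Rinv_l rho) by lra. apply Rmult_lt_compat_l; lra. }
  nra. }
unfold ellipse_level, joukowski_x, joukowski_y. simpl fst; simpl snd.
set (a := / 2 * (rho + / rho)) in *. set (b := / 2 * (rho - / rho)) in *.
assert (Hlt : forall u c, 0 < c -> - c < u < c -> (u / c) ^ 2 < 1).
{ intros u c Hc Hu.
  apply (Rmult_lt_reg_r (c ^ 2)); [apply pow_lt, Hc|].
  replace ((u / c) ^ 2 * c ^ 2) with (u ^ 2) by (field; lra). nra. }
assert (H1 := Hlt (/ 2 * (r + / r)) a Ha ltac:(unfold a; lra)).
assert (H2 := Hlt (/ 2 * (r - / r)) b Hb ltac:(unfold b; lra)).
replace (/ 2 * (r + / r) * cos t / a) with (/ 2 * (r + / r) / a * cos t) by (field; lra).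
replace (/ 2 * (r - / r) * sin t / b) with (/ 2 * (r - / r) / b * sin t) by (field; lra).
rewrite !Rpow_mult_distr.
pose proof (sin2_cos2 t) as Hsc. unfold Rsqr in Hsc.
pose proof (pow2_ge_0 (cos t)). pose proof (pow2_ge_0 (sin t)).
set (A := (/ 2 * (r + / r) / a) ^ 2) in *. set (B := (/ 2 * (r - / r) / b) ^ 2) in *.
assert (Hsc' : sin t ^ 2 + cos t ^ 2 = 1) by (simpl; lra).
(* One of cos^2 t and sin^2 t is at least 1/2, which makes the inequality strict. *)
destruct (Rle_dec (cos t ^ 2) (/ 2)); nra.
Qed.

(** * Integrals *)

Lemma RInt_eq_at_endpoint (g : R -> R -> R) (a b r0 r1 L : R) :
  a <= b -> r0 < r1 ->
  (forall s, r0 < s < r1 -> RInt (g s) a b = L) ->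
  (forall s t, r0 < s <= r1 -> a <= t <= b -> continuous (g s) t) ->
  (forall t, a <= t <= b -> continuity_2d_pt g r1 t) ->
  RInt (g r1) a b = L.
Proof.
intros Hab Hr HL Hc Hc2.
apply Rminus_diag_uniq, Rabs_eq_0, Rle_antisym; [|apply Rabs_pos].
apply le_epsilon. intros eps Heps. rewrite Rplus_0_l.
(* The added 1 keeps the denominator positive when a = b. *)
assert (Heps' : 0 < eps / (b - a + 1)) by (apply Rdiv_lt_0_compat; lra).
destruct (uniform_continuity_2d_1d (fun t s => g s t) a b r1) with (eps := mkposreal _ Heps')
  as [d Hd].
{ intros t Ht e. destruct (Hc2 t Ht e) as [d Hd].
  exists d. intros u v Hu Hv. now apply Hd. }
simpl in Hd.
(* A radius in the open interval, within the modulus of continuity d of r1. *)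
set (s := Rmax ((r0 + r1) / 2) (r1 - d / 2)).
assert (Hs : r0 < s < r1 /\ r1 - d <= s).
{ pose proof (cond_pos d). unfold s. repeat split.
  - eapply Rlt_le_trans; [|apply Rmax_l]. lra.
  - apply Rmax_lub_lt; lra.
  - eapply Rle_trans; [|apply Rmax_r]. lra. }
assert (Hex : forall s, r0 < s <= r1 -> ex_RInt (g s) a b).
{ intros u Hu. apply (ex_RInt_continuous (V := R_CompleteNormedModule)). intros t Ht.
  rewrite Rmin_left, Rmax_right in Ht by exact Hab. now apply Hc. }
rewrite <- (HL s) by tauto.
rewrite <- (RInt_minus (V := R_CompleteNormedModule)) by (apply Hex; lra).
apply Rle_trans with ((b - a) * (eps / (b - a + 1))).
- apply abs_RInt_le_const; [exact Hab| |].
  + apply (ex_RInt_minus (V := R_CompleteNormedModule)); apply Hex; lra.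
  + intros t Ht. apply Rlt_le.
    apply (Hd t s t r1); try lra; [pose proof (cond_pos d); lra ..|].
    rewrite Rminus_eq_0, Rabs_R0. apply cond_pos.
- apply (Rmult_le_reg_r (b - a + 1)); [lra|].
  replace ((b - a) * (eps / (b - a + 1)) * (b - a + 1)) with ((b - a) * eps) by (field; lra).
  nra.
Qed.

Lemma constant_of_is_derive_0 (I : R -> R) (r0 r1 x y : R) :
  (forall s, r0 < s < r1 -> is_derive I s 0) ->
  r0 < x < r1 -> r0 < y < r1 -> I x = I y.
Proof.
intros H Hx Hy.
assert (Hin : forall s, Rmin x y <= s <= Rmax x y -> r0 < s < r1).
{ intros s. unfold Rmin, Rmax. destruct (Rle_dec x y); lra. }
destruct (MVT_gen I x y (fun _ => 0)) as [c [_ Hc]].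
- intros s Hs. apply H, Hin. lra.
- intros s Hs. apply continuity_pt_filterlim.
  apply (ex_derive_continuous (K := R_AbsRing) (V := R_NormedModule) I).
  exists 0. now apply H, Hin.
- lra.
Qed.

Lemma is_derive_acos (x : R) : -1 < x < 1 -> is_derive acos x (- / sqrt (1 - x ^ 2)).
Proof.
intros Hx. apply is_derive_Reals.
replace (- / sqrt (1 - x ^ 2)) with (derive_pt acos x (derivable_pt_acos x Hx)).
- apply (derive_pt_eq_1 _ _ _ (derivable_pt_acos x Hx)). reflexivity.
- rewrite derive_pt_acos. unfold Rsqr, Rdiv. simpl. rewrite Rmult_1_r. ring.
Qed.

(** Differentiability of [acos] fails at the endpoints, so the limit is read off from the
    monotonicity of cos. The clause -1 < a < 1 keeps the later substitution on intervals where
    [acos] is smooth. *)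
Lemma acos_at_right_opp1 (eps : R) : 0 < eps ->
  at_right (-1) (fun a => -1 < a < 1 /\ Rabs (acos a - PI) < eps).
Proof.
intros Heps. pose proof PI_RGT_0.
(* The cap at PI keeps PI - e in [0, PI], where cos is decreasing. *)
set (e := Rmin eps PI).
assert (He : 0 < e <= PI /\ e <= eps).
{ unfold e. repeat split; [apply Rmin_pos; lra | apply Rmin_r | apply Rmin_l]. }
assert (Hd : 0 < cos (PI - e) + 1).
{ assert (H1 : cos PI < cos (PI - e)) by (apply cos_decreasing_1; lra).
  rewrite cos_PI in H1. lra. }
exists (mkposreal _ Hd). intros a Ha Ha1.
assert (Ha' : a < cos (PI - e)).
{ change (Rabs (a - -1) < cos (PI - e) + 1) in Ha. apply Rabs_def2 in Ha. lra. }
pose proof (COS_bound (PI - e)). pose proof (acos_bound a).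
split; [lra|].
assert (PI - e < acos a).
{ apply Rnot_le_lt. intros Hle.
  assert (cos (PI - e) <= cos (acos a)) by (apply cos_decr_1; lra).
  rewrite cos_acos in H2; lra. }
apply Rabs_def1; lra.
Qed.

Lemma acos_at_left_1 (eps : R) : 0 < eps ->
  at_left 1 (fun a => -1 < a < 1 /\ Rabs (acos a - 0) < eps).
Proof.
intros Heps. pose proof PI_RGT_0.
set (e := Rmin eps PI).
assert (He : 0 < e <= PI /\ e <= eps).
{ unfold e. repeat split; [apply Rmin_pos; lra | apply Rmin_r | apply Rmin_l]. }
assert (Hd : 0 < 1 - cos e).
{ assert (H1 : cos e < cos 0) by (apply cos_decreasing_1; lra).
  rewrite cos_0 in H1. lra. }
exists (mkposreal _ Hd). intros a Ha Ha1.
assert (Ha' : cos e < a).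
{ change (Rabs (a - 1) < 1 - cos e) in Ha. apply Rabs_def2 in Ha. lra. }
pose proof (COS_bound e). pose proof (acos_bound a).
split; [lra|].
assert (acos a < e).
{ apply Rnot_le_lt. intros Hle.
  assert (cos (acos a) <= cos e) by (apply cos_decr_1; lra).
  rewrite cos_acos in H2; lra. }
apply Rabs_def1; lra.
Qed.

(** On [a, b] inside (-1, 1) the substitution t = acos x is regular and gives minus the integral of
    h from acos a to acos b, as [acos] decreases. Continuity of the integral in its endpoints then
    yields both convergence of the improper integral and its value. *)
Lemma RInt_gen_cos_subst {V : CompleteNormedModule R_AbsRing} (h : R -> V) (F : R -> V) :
  (forall t, continuous h t) ->
  (forall x, -1 < x < 1 -> F x = scal (/ sqrt (1 - x ^ 2)) (h (acos x))) ->
  RInt_gen F (at_right (-1)) (at_left 1) = RInt h 0 PI.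
Proof.
intros Hh HF.
assert (Hex : forall a b, ex_RInt h a b).
{ intros a b. apply ex_RInt_continuous. intros t _. apply Hh. }
apply is_RInt_gen_unique.
refine (proj2 (filterlimi_locally _ _) _).
intros eps.
assert (Hc : continuous (fun z => opp (RInt h (fst z) (snd z))) (PI, 0)).
{ apply (continuous_opp (V := V)). apply (continuous_RInt h PI 0 (RInt h)).
  apply filter_forall. intros [a b]. apply RInt_correct, Hex. }
destruct (proj1 (filterlim_locally _ _) Hc eps) as [d Hd].
apply (Filter_prod _ _ _ (fun a => -1 < a < 1 /\ Rabs (acos a - PI) < d)
        (fun b => -1 < b < 1 /\ Rabs (acos b - 0) < d)).
- apply acos_at_right_opp1, cond_pos.
- apply acos_at_left_1, cond_pos.
- intros a b [Ha Had] [Hb Hbd].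
  exists (opp (RInt h (acos a) (acos b))). split.
  + assert (Hin : forall x, Rmin a b <= x <= Rmax a b -> -1 < x < 1).
    { intros x. unfold Rmin, Rmax. destruct (Rle_dec a b); lra. }
    apply (is_RInt_ext (fun x => opp (scal (- / sqrt (1 - x ^ 2)) (h (acos x))))).
    { intros x Hx. simpl in Hx. rewrite HF by (apply Hin; lra).
      rewrite <- scal_opp_l. f_equal. apply Ropp_involutive. }
    apply (is_RInt_opp (V := V)).
    apply (is_RInt_comp h acos (fun x => - / sqrt (1 - x ^ 2))).
    * intros x _. apply Hh.
    * intros x Hx. specialize (Hin x Hx). split; [now apply is_derive_acos|].
      apply (ex_derive_continuous (K := R_AbsRing) (V := R_NormedModule)).
      assert (0 < 1 - x * (x * 1)) by nra.
      auto_derive. split; [assumption|]. split; [|exact I].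
      apply Rgt_not_eq, sqrt_lt_R0. assumption.
  + rewrite <- (opp_RInt_swap h PI 0) by apply Hex.
    apply (Hd (acos a, acos b)). split; simpl; assumption.
Qed.

Lemma RInt_fold_2PI (g : R -> R) :
  (forall t, continuous g t) ->
  RInt g 0 (2 * PI) = RInt (fun t => g t + g (2 * PI - t)) 0 PI.
Proof.
intros Hg.
assert (Hex : forall a b, ex_RInt g a b).
{ intros a b. apply (ex_RInt_continuous (V := R_CompleteNormedModule)). intros t _. apply Hg. }
assert (Hex' : ex_RInt (fun t => g (2 * PI - t)) 0 PI).
{ apply (ex_RInt_continuous (V := R_CompleteNormedModule)). intros t _.
  apply (continuous_comp (fun s => 2 * PI - s) g); [|apply Hg].
  apply continuous_R_minus; [apply continuous_const | apply continuous_id]. }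
rewrite (RInt_plus (V := R_CompleteNormedModule)) by auto.
rewrite <- (RInt_Chasles (V := R_CompleteNormedModule) g 0 PI (2 * PI)) by apply Hex.
f_equal.
pose proof (RInt_comp_lin (V := R_CompleteNormedModule) g (-1) (2 * PI) 0 PI (Hex _ _)) as H.
replace (-1 * 0 + 2 * PI) with (2 * PI) in H by ring.
replace (-1 * PI + 2 * PI) with PI in H by ring.
rewrite <- (opp_RInt_swap (V := R_CompleteNormedModule) g (2 * PI) PI), <- H by apply Hex.
rewrite <- (RInt_opp (V := R_CompleteNormedModule)).
- apply RInt_ext. intros t _.
  change (- (-1 * g (-1 * t + 2 * PI)) = g (2 * PI - t)).
  replace (-1 * t + 2 * PI) with (2 * PI - t) by ring. ring.
- apply (ex_RInt_comp_lin (V := R_CompleteNormedModule)), Hex.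
Qed.

Lemma RInt_C_pair (h : R -> C) (a b : R) :
  ex_RInt (fun t => fst (h t)) a b -> ex_RInt (fun t => snd (h t)) a b ->
  RInt (V := C_R_CompleteNormedModule) h a b
  = (RInt (fun t => fst (h t)) a b, RInt (fun t => snd (h t)) a b).
Proof.
intros H1 H2. apply is_RInt_unique.
apply (is_RInt_fct_extend_pair (U := R_NormedModule) (V := R_NormedModule));
  apply (RInt_correct (V := R_CompleteNormedModule)); assumption.
Qed.

Lemma continuous_C_pair (A B : R -> R) (t : R) :
  continuous A t -> continuous B t ->
  continuous (fun s => (A s, B s) : C_R_CompleteNormedModule) t.
Proof.
intros HA HB.
apply (continuous_comp_2 A B (fun a b => (a, b) : C_R_CompleteNormedModule)); [exact HA|exact HB|].
apply (continuous_ext (fun z : R * R => z)).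
- intros [u v]. reflexivity.
- apply (continuous_id (U := prod_UniformSpace R_UniformSpace R_UniformSpace)).
Qed.

(** * Circle means and Chebyshev coefficients *)

(** On the outer circle the angle is kept in [0, 2 PI], the range that parametrises
    [bernstein_ellipse]. *)
Lemma C1_on_closed_annulus (rho : R) (f : C -> C) (r t : R) : 1 < rho ->
  analytic_inside_and_on (bernstein_ellipse rho) f ->
  / rho < r < rho \/ r = rho /\ 0 <= t <= 2 * PI ->
  C1_holomorphic_at f (joukowski_x r t) (joukowski_y r t).
Proof.
intros Hrho Hf Hr. apply analytic_at_C1, Hf. destruct Hr as [Hr|[-> Ht]].
- left. now apply joukowski_inside.
- right. apply bernstein_ellipse_joukowski; [lra|]. now exists t.
Qed.

Lemma trig_2PI_minus (n : nat) (t : R) :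
  cos (INR n * (2 * PI - t)) = cos (INR n * t) /\
  sin (INR n * (2 * PI - t)) = - sin (INR n * t).
Proof.
replace (INR n * (2 * PI - t)) with (- (INR n * t) + 2 * INR n * PI) by ring.
now rewrite cos_period, sin_period, cos_neg, sin_neg.
Qed.

Lemma polar_2PI (f : C -> C) (n : nat) (r : R) :
  polar_re f n r 0 = polar_re f n r (2 * PI) /\ polar_im f n r 0 = polar_im f n r (2 * PI).
Proof.
destruct (trig_2PI_minus n 0) as [Hc Hs].
rewrite Rminus_0_r, Rmult_0_r in Hc, Hs. rewrite sin_0, Ropp_0 in Hs. rewrite cos_0 in Hc.
unfold polar_re, polar_im, joukowski_x, joukowski_y.
now rewrite Hc, Hs, cos_2PI, sin_2PI, Rmult_0_r, cos_0, sin_0.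
Qed.

Lemma circle_integral_constant (rho : R) (f : C -> C) (n : nat) : 1 < rho ->
  analytic_inside_and_on (bernstein_ellipse rho) f ->
  RInt (polar_re f n rho) 0 (2 * PI) = RInt (polar_re f n 1) 0 (2 * PI) /\
  RInt (polar_im f n rho) 0 (2 * PI) = RInt (polar_im f n 1) 0 (2 * PI).
Proof.
intros Hrho Hf.
assert (Hinv : 0 < / rho < 1).
{ split; [apply Rinv_0_lt_compat; lra|]. rewrite <- Rinv_1. apply Rinv_lt_contravar; lra. }
pose proof PI_RGT_0.
assert (HC1 : forall r t, / rho < r < rho ->
  C1_holomorphic_at f (joukowski_x r t) (joukowski_y r t)).
{ intros r t Hr. apply (C1_on_closed_annulus rho); tauto. }
assert (HC1' : forall r t, / rho < r <= rho -> 0 <= t <= 2 * PI ->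
  C1_holomorphic_at f (joukowski_x r t) (joukowski_y r t)).
{ intros r t Hr Ht. apply (C1_on_closed_annulus rho); [exact Hrho | exact Hf |].
  destruct (Req_dec r rho); [right | left]; [tauto | lra]. }
assert (Hcont : forall r t, r <> 0 -> C1_holomorphic_at f (joukowski_x r t) (joukowski_y r t) ->
  continuous (polar_re f n r) t /\ continuous (polar_im f n r) t).
{ intros r t Hr H1. destruct (is_derive_polar_t f n r t Hr H1) as [HP HQ].
  split; apply (ex_derive_continuous (K := R_AbsRing) (V := R_NormedModule));
    eexists; eassumption. }
split; apply (RInt_eq_at_endpoint _ _ _ (/ rho)); try lra.
- intros s Hs. apply (constant_of_is_derive_0 (fun u => RInt (polar_re f n u) 0 (2 * PI))
    (/ rho) rho); [|lra..].
  intros r Hr. apply (is_derive_RInt_conjugate_zero _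
      (polar_im f n) (polar_re_dr f n) _ _ (/ rho) rho);
    [lra | lra | intros u v Hu .. | exact (proj2 (polar_2PI f n r))].
  + refine (proj1 (is_derive_polar_r f n u v _ (HC1 u v Hu))). lra.
  + refine (proj2 (is_derive_polar_t f n u v _ (HC1 u v Hu))). lra.
  + refine (proj1 (proj2 (proj2 (continuity_polar f n u v _ (HC1 u v Hu))))). lra.
  + refine (proj1 (Hcont u v _ (HC1 u v Hu))). lra.
- intros s t Hs Ht. refine (proj1 (Hcont s t _ (HC1' s t Hs Ht))). lra.
- intros t Ht. refine (proj1 (continuity_polar f n rho t _ (HC1' rho t _ Ht))); lra.
(* The imaginary part is the real part of -i times the function, whose conjugate is -Re. *)
- intros s Hs. apply (constant_of_is_derive_0 (fun u => RInt (polar_im f n u) 0 (2 * PI))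
    (/ rho) rho); [|lra..].
  intros r Hr. apply (is_derive_RInt_conjugate_zero _
      (fun u v => - polar_re f n u v) (polar_im_dr f n)
      _ _ (/ rho) rho);
    [lra | lra | intros u v Hu .. | exact (f_equal Ropp (proj1 (polar_2PI f n r)))].
  + refine (proj2 (is_derive_polar_r f n u v _ (HC1 u v Hu))). lra.
  + rewrite <- (Ropp_involutive (u * polar_im_dr f n u v)).
    apply (is_derive_opp (V := R_NormedModule)).
    refine (proj1 (is_derive_polar_t f n u v _ (HC1 u v Hu))). lra.
  + refine (proj2 (proj2 (proj2 (continuity_polar f n u v _ (HC1 u v Hu))))). lra.
  + refine (proj2 (Hcont u v _ (HC1 u v Hu))). lra.
- intros s t Hs Ht. refine (proj2 (Hcont s t _ (HC1' s t Hs Ht))). lra.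
- intros t Ht. refine (proj1 (proj2 (continuity_polar f n rho t _ (HC1' rho t _ Ht)))); lra.
Qed.

Lemma joukowski_1 (t : R) : joukowski_x 1 t = cos t /\ joukowski_y 1 t = 0.
Proof. unfold joukowski_x, joukowski_y. rewrite Rinv_1. split; field. Qed.

Lemma continuous_comp_cos (rho : R) (f : C -> C) (n : nat) (t : R) : 1 < rho ->
  analytic_inside_and_on (bernstein_ellipse rho) f ->
  continuous (fun s => re_part f (cos s) 0 * cos (INR n * s)) t /\
  continuous (fun s => im_part f (cos s) 0 * cos (INR n * s)) t /\
  continuous (polar_re f n 1) t /\ continuous (polar_im f n 1) t.
Proof.
intros Hrho Hf.
assert (HC1 : C1_holomorphic_at f (joukowski_x 1 t) (joukowski_y 1 t)).
{ apply (C1_on_closed_annulus rho); [exact Hrho | exact Hf | left].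
  split; [|exact Hrho]. rewrite <- Rinv_1. apply Rinv_lt_contravar; lra. }
assert (Hcont : forall (g : R -> R) l, is_derive g t l -> continuous g t).
{ intros g l Hg. apply (ex_derive_continuous (K := R_AbsRing) (V := R_NormedModule)).
  now exists l. }
destruct (is_derive_comp_t f 1 t R1_neq_R0 HC1) as [HU HV].
destruct (is_derive_polar_t f n 1 t R1_neq_R0 HC1) as [HP HQ].
assert (Hcos : continuous (fun s => cos (INR n * s)) t).
{ eapply Hcont. auto_derive; [exact I | reflexivity]. }
repeat split; [| | exact (Hcont _ _ HP) | exact (Hcont _ _ HQ)].
- apply continuous_R_mult; [|exact Hcos].
  apply (continuous_ext _ _ _) with (2 := Hcont _ _ HU).
  intros s. destruct (joukowski_1 s) as [-> ->]. reflexivity.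
- apply continuous_R_mult; [|exact Hcos].
  apply (continuous_ext _ _ _) with (2 := Hcont _ _ HV).
  intros s. destruct (joukowski_1 s) as [-> ->]. reflexivity.
Qed.

(** The reflection t -> 2 PI - t fixes cos t and cos(nt) and negates sin(nt): the sine terms cancel
    and the cosine terms double. *)
Lemma RInt_unit_circle (rho : R) (f : C -> C) (n : nat) : 1 < rho ->
  analytic_inside_and_on (bernstein_ellipse rho) f ->
  RInt (polar_re f n 1) 0 (2 * PI)
    = 2 * RInt (fun t => re_part f (cos t) 0 * cos (INR n * t)) 0 PI /\
  RInt (polar_im f n 1) 0 (2 * PI)
    = 2 * RInt (fun t => im_part f (cos t) 0 * cos (INR n * t)) 0 PI.
Proof.
intros Hrho Hf.
pose proof (fun t => continuous_comp_cos rho f n t Hrho Hf) as Hc.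
assert (Hcos : forall t, cos (2 * PI - t) = cos t).
{ intros t. pose proof (proj1 (trig_2PI_minus 1 t)) as H. simpl in H.
  now rewrite !Rmult_1_l in H. }
assert (Hscal : forall g : R -> R, (forall t, continuous g t) ->
  RInt (fun t => 2 * g t) 0 PI = 2 * RInt g 0 PI).
{ intros g Hg. apply (RInt_scal (V := R_CompleteNormedModule)).
  apply (ex_RInt_continuous (V := R_CompleteNormedModule)). intros t _. apply Hg. }
split;
  rewrite RInt_fold_2PI, <- Hscal by (intros t; destruct (Hc t) as [? [? [? ?]]]; assumption);
  apply RInt_ext; intros t _; unfold polar_re, polar_im;
  destruct (joukowski_1 t) as [-> ->], (joukowski_1 (2 * PI - t)) as [-> ->],
    (trig_2PI_minus n t) as [-> ->]; rewrite Hcos, Rinv_1, pow1.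
- change (1 * (re_part f (cos t) 0 * cos (INR n * t) + im_part f (cos t) 0 * sin (INR n * t)) +
    1 * (re_part f (cos t) 0 * cos (INR n * t) + im_part f (cos t) 0 * - sin (INR n * t))
    = 2 * (re_part f (cos t) 0 * cos (INR n * t))). ring.
- change (1 * (im_part f (cos t) 0 * cos (INR n * t) - re_part f (cos t) 0 * sin (INR n * t)) +
    1 * (im_part f (cos t) 0 * cos (INR n * t) - re_part f (cos t) 0 * - sin (INR n * t))
    = 2 * (im_part f (cos t) 0 * cos (INR n * t))). ring.
Qed.

Lemma chebyshev_coeff_cos (rho : R) (f : C -> C) (n : nat) : 1 < rho ->
  analytic_inside_and_on (bernstein_ellipse rho) f ->
  chebyshev_coeff f n =
  Cmult (2 / PI)%R (RInt (fun t => re_part f (cos t) 0 * cos (INR n * t)) 0 PI,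
                    RInt (fun t => im_part f (cos t) 0 * cos (INR n * t)) 0 PI).
Proof.
intros Hrho Hf.
pose proof (fun t => continuous_comp_cos rho f n t Hrho Hf) as Hc.
pose proof PI_RGT_0.
unfold chebyshev_coeff. rewrite RtoC_div by lra. f_equal.
rewrite (RInt_gen_cos_subst (V := C_R_CompleteNormedModule)
  (fun t => ((re_part f (cos t) 0 * cos (INR n * t))%R,
             (im_part f (cos t) 0 * cos (INR n * t))%R))).
- apply RInt_C_pair; apply (ex_RInt_continuous (V := R_CompleteNormedModule)); intros t _.
  + exact (proj1 (Hc t)).
  + exact (proj1 (proj2 (Hc t))).
- intros t. apply continuous_C_pair; [exact (proj1 (Hc t)) | exact (proj1 (proj2 (Hc t)))].
(* With t = acos x, T_n(x) is cos(nt), and the Chebyshev weight is exactly the scalar factor of the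
   substitution. *)
- intros x Hx.
  assert (Hs : 0 < sqrt (1 - x ^ 2)) by (apply sqrt_lt_R0; nra).
  rewrite <- chebyshev_T_cos, cos_acos by lra.
  unfold Cdiv. rewrite <- RtoC_inv by lra. unfold re_part, im_part.
  change (f (x, 0)) with (f (RtoC x)). destruct (f (RtoC x)) as [u v].
  unfold scal; simpl. unfold prod_scal, scal, Cmult, RtoC; simpl. unfold mult; simpl.
  f_equal; ring.
Qed.

Theorem lemma2p1 (rho : R) (f : C -> C) (hrho : 1 < rho)
    (hf : analytic_inside_and_on (bernstein_ellipse rho) f) (n : nat) :
  chebyshev_coeff f n =
  (/ (PI * rho ^ n)%R *
   RInt (V := C_R_CompleteNormedModule)
     (fun theta : R =>
        f (/ 2 * (rho * cis theta + / (rho * cis theta)))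
        * cis (- (INR n * theta))%R)
     0 (2 * PI)%R)%C.
Proof.
pose proof PI_RGT_0.
assert (Hpow : 0 < rho ^ n) by (apply pow_lt; lra).
(* The polar parts carry the factor rho^(-n) of 1/u^n, so rho^n restores the stated integrand; it
   later cancels against the prefactor. *)
assert (E : forall t, (f (/ 2 * (rho * cis t + / (rho * cis t))) * cis (- (INR n * t)))%C
  = (rho ^ n * polar_re f n rho t, rho ^ n * polar_im f n rho t)).
{ intros t. rewrite joukowski_cis by lra.
  unfold polar_re, polar_im, re_part, im_part, cis.
  rewrite cos_neg, sin_neg, pow_inv.
  destruct (f (joukowski_x rho t, joukowski_y rho t)) as [u v].
  unfold Cmult; simpl. f_equal; field; lra. }
rewrite (RInt_ext (V := C_R_CompleteNormedModule) _ _ _ _ (fun t _ => E t)).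
assert (Hex : ex_RInt (polar_re f n rho) 0 (2 * PI) /\ ex_RInt (polar_im f n rho) 0 (2 * PI)).
{ assert (Hd : forall t, Rmin 0 (2 * PI) <= t <= Rmax 0 (2 * PI) ->
    ex_derive (polar_re f n rho) t /\ ex_derive (polar_im f n rho) t).
  { intros t Ht. rewrite Rmin_left, Rmax_right in Ht by lra.
    assert (HC1 : C1_holomorphic_at f (joukowski_x rho t) (joukowski_y rho t)).
    { apply (C1_on_closed_annulus rho); auto. }
    destruct (is_derive_polar_t f n rho t ltac:(lra) HC1).
    split; eexists; eassumption. }
  split; apply (ex_RInt_continuous (V := R_CompleteNormedModule)); intros t Ht;
    apply (ex_derive_continuous (K := R_AbsRing) (V := R_NormedModule)); now apply Hd. }
destruct Hex as [HexP HexQ].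
rewrite RInt_C_pair.
2:{ apply (ex_RInt_scal (V := R_NormedModule) (polar_re f n rho)), HexP. }
2:{ apply (ex_RInt_scal (V := R_NormedModule) (polar_im f n rho)), HexQ. }
simpl fst; simpl snd.
rewrite (RInt_scal (V := R_CompleteNormedModule) (polar_re f n rho)) by exact HexP.
rewrite (RInt_scal (V := R_CompleteNormedModule) (polar_im f n rho)) by exact HexQ.
destruct (circle_integral_constant rho f n hrho hf) as [-> ->].
destruct (RInt_unit_circle rho f n hrho hf) as [-> ->].
rewrite (chebyshev_coeff_cos rho f n hrho hf).
rewrite <- RtoC_inv by nra.
unfold Cmult, RtoC, scal; simpl. unfold mult; simpl.
f_equal; field; lra.
Qed.
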